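(* Let $p$ be a prime and let $(\mathcal{A}_p,f)$ be a connected affine quandle of order $p$, where $f(x)=tx$ on $\mathbb{Z}_p$ and the order $n$ of $f$ satisfies $\gcd(n,2)=2$. For $k\in\mathcal{A}_p=\mathbb{Z}_p$ put $$A(k)=\{(i,i+tk),(i,i+t^2k),\dots,(i,i+t^nk)\mid i\in\mathcal{A}_p\}.$$ Then $\mathcal{A}_p\otimes\mathcal{A}_p/\langle\tau\rangle$ consists of $1+(p-1)/n$ elements of the form $A(k)$; that is, it has exactly $1+(p-1)/n$ elements, each of which is the class of some $A(k)\in\mathcal{A}_p\otimes\mathcal{A}_p$, $k\in\mathcal{A}_p$.
   Context: A quandle is a set $X$ with a binary operation $\triangleright$ such that $x\triangleright x=x$; for all $x,y$ there is a unique $z$ with $x=z\triangleright y$ (this $z$ is denoted $x\triangleright^{-1}y$); and $(x\triangleright y)\triangleright z=(x\triangleright z)\triangleright(y\triangleright z)$. $Inn(X)$ is the group of permutations of $X$ generated by the maps $R_y(x)=x\triangleright y$; $X$ is connected if $Inn(X)$ acts transitively on $X$. For $t\in\mathbb{Z}_p^{\ast}$ and $f(x)=tx$, $(\mathcal{A}_p,f)$ is the affine quandle on $\mathbb{Z}_p$ with $x\triangleright y=tx+(1-t)y$; the order $n$ of $f$ is the least $n\in\mathbb{N}$ with $t^n\equiv1\pmod p$. Let $F(X)$ be the free group on the set $X$. It acts on $X$ on the right by $x\cdot g=((x\triangleright^{\epsilon_1}x_1)\triangleright^{\epsilon_2}x_2\cdots)\triangleright^{\epsilon_m}x_m$ for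 $g=x_1^{\epsilon_1}\cdots x_m^{\epsilon_m}$ with $\epsilon_i=\pm1$, $\triangleright^{1}=\triangleright$, and on the left by $g\cdot x=x\cdot g^{-1}$. The (canonical) tensor product $X\otimes X$ is the set of equivalence classes $[(x,y)]$ of $X\times X$ under the equivalence relation generated by $(x\cdot g,y)\sim(x,g\cdot y)$ for $x,y\in X$, $g\in F(X)$. Equivalently, $X\otimes X$ is the set of orbits of $Inn(X)$ acting diagonally on $X\times X$. The map $\tau(x,y)=(y,x)$ on $X\times X$ induces an involution $\tau[(x,y)]=[(y,x)]$ of $X\otimes X$, and $X\otimes X/\langle\tau\rangle$ denotes the set of orbits of this involution on $X\otimes X$. *)

(* Defs.v *)
From HB Require Import structures.
From mathcomp Require Import all_boot all_fingroup all_algebra.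
From mathcomp Require Import boolp.
From Stdlib Require Import Relation_Operators.

Set Implicit Arguments.
Unset Strict Implicit.
Unset Printing Implicit Defensive.

HB.mixin Record isQuandle X of Choice X := {
  qop : X -> X -> X;
  qopxx : forall x, qop x x = x;
  qop_uniq : forall x y, exists! z, x = qop z y;
  qopD : forall x y z, qop (qop x y) z = qop (qop x z) (qop y z)
}.

#[short(type="quandleType")]
HB.structure Definition Quandle := {X of isQuandle X & Choice X}.

#[short(type="finQuandleType")]
HB.structure Definition FinQuandle := {X of isQuandle X & Finite X}.

Declare Scope quandle_scope.
Local Open Scope quandle_scope.

Notation "x ▷ y" := (qop x y) (at level 40, left associativity) : quandle_scope.

Lemma qop_exists (X : quandleType) (x y : X) : exists z, x == z ▷ y.
Proof. by have [z [-> _]] := qop_uniq x y; exists z. Qed.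

Definition qinv (X : quandleType) (x y : X) : X := xchoose (qop_exists x y).

Notation "x ▷⁻¹ y" := (qinv x y) (at level 40, left associativity)
  : quandle_scope.

Section QuandleTheory.
Variable X : quandleType.
Implicit Types x y z : X.

Lemma qinvK x y : (x ▷⁻¹ y) ▷ y = x.
Proof. by rewrite /qinv -(eqP (xchooseP (qop_exists x y))). Qed.

Lemma qop_inj y : injective (fun x => x ▷ y).
Proof.
move=> a b /= eq_ab; have [z [_ zP]] := qop_uniq (a ▷ y) y.
by rewrite -(zP a) // -(zP b).
Qed.

Lemma qopK x y : (x ▷ y) ▷⁻¹ y = x.
Proof. by apply: (@qop_inj y); rewrite qinvK. Qed.

End QuandleTheory.

Section Inner.
Variable X : finQuandleType.

Definition qright (y : X) : {perm X} := perm (@qop_inj X y).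

Definition Inn : {group {perm X}} := <<[set qright y | y : X]>>%G.

Definition connected_quandle : bool := [transitive Inn, on [set: X] | 'P].

End Inner.

(* The free group on X is realised by reduced words. The letter (x, false)
   stands for x and the letter (x, true) for its inverse. *)
Section FreeGroup.
Variable X : choiceType.
Implicit Types (a b : X * bool) (u v w : seq (X * bool)).

Definition letter_inv a : X * bool := (a.1, ~~ a.2).

Definition reduced w : bool := sorted (fun a b => b != letter_inv a) w.

Definition push a w : seq (X * bool) :=
  if w is b :: w' then (if b == letter_inv a then w' else a :: w) else [:: a].

Definition reduce_word w : seq (X * bool) := foldr push [::] w.

Definition word_inv w : seq (X * bool) := rev (map letter_inv w).

Lemma letter_invK : involutive letter_inv.
Proof. by case=> x b; rewrite /letter_inv /= negbK. Qed.

Lemma reduced_push a w : reduced w -> reduced (push a w).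
Proof.
case: w => [|b w] //= w_red; case: eqP => [_|/eqP ne]; first exact: path_sorted w_red.
by rewrite /= ne.
Qed.

Lemma pushK a w : reduced w -> push (letter_inv a) (push a w) = w.
Proof.
case: w => [|b w] /=; first by rewrite letter_invK eqxx.
case: eqP => [->|_ _] /=; last by rewrite letter_invK eqxx.
case: w => [|c w] //= /andP[ne _].
by rewrite (negPf ne).
Qed.

Lemma reduced_foldr u w : reduced w -> reduced (foldr push w u).
Proof. by move=> w_red; elim: u => //= a u; apply: reduced_push. Qed.

Lemma reduced_reduce w : reduced (reduce_word w).
Proof. exact: reduced_foldr. Qed.

Lemma reduce_id w : reduced w -> reduce_word w = w.
Proof.
elim: w => [|a w IH] //= aw_red; have w_red := path_sorted aw_red.
rewrite /reduce_word /= -/(reduce_word w) IH // /push.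
by case: w aw_red {w_red IH} => [|b w] //= /andP[/negPf->].
Qed.

Lemma foldr_push a u w : reduced w ->
  foldr push w (push a u) = push a (foldr push w u).
Proof.
case: u => [|b u] //= w_red; case: eqP => [->|_] //=.
by rewrite -[in X in push X](letter_invK a) pushK // reduced_foldr.
Qed.

Lemma foldr_reduce u w : reduced w ->
  foldr push w (reduce_word u) = foldr push w u.
Proof. by move=> w_red; elim: u => //= a u IH; rewrite foldr_push // IH. Qed.

Lemma reduced_inv w : reduced w -> reduced (word_inv w).
Proof.
rewrite /reduced /word_inv rev_sorted sorted_map; apply: sub_sorted => a b ne.
by rewrite /= letter_invK; apply: contraNneq ne => ->.
Qed.

Lemma foldr_pushV u w : reduced w -> foldr push (foldr push w u) (word_inv u) = w.
Proof.
elim: u w => [|a u IH] w w_red //=.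
rewrite /word_inv /= rev_cons -cats1 foldr_cat /= pushK ?reduced_foldr //.
exact: IH.
Qed.

Lemma word_invK : involutive word_inv.
Proof.
move=> w; rewrite /word_inv map_rev revK -map_comp -[RHS]map_id.
by apply: eq_map => a /=; rewrite letter_invK.
Qed.

Record free_group := FreeGroup { word : seq (X * bool); _ : reduced word }.

HB.instance Definition _ := [isSub for word].
HB.instance Definition _ := [Choice of free_group by <:].

Definition free_one := @FreeGroup [::] isT.
Definition free_mul (g h : free_group) : free_group :=
  FreeGroup (reduced_reduce (word g ++ word h)).
Definition free_inv (g : free_group) : free_group :=
  FreeGroup (reduced_inv (valP g)).

Lemma word_mul g h : word (free_mul g h) = foldr push (word h) (word g).
Proof.
rewrite /= /reduce_word foldr_cat -/(reduce_word (word h)).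
by rewrite (reduce_id (valP h)).
Qed.

Lemma free_mulA : associative free_mul.
Proof.
move=> g h k; apply: val_inj; rewrite [LHS]word_mul [RHS]word_mul word_mul.
by rewrite /= (foldr_reduce _ (valP k)) foldr_cat.
Qed.

Lemma free_mul1 : left_id free_one free_mul.
Proof. by move=> g; apply: val_inj; rewrite /= reduce_id ?(valP g). Qed.

Lemma free_1mul : right_id free_one free_mul.
Proof. by move=> g; apply: val_inj; rewrite /= cats0 reduce_id ?(valP g). Qed.

Lemma free_mulV : left_inverse free_one free_inv free_mul.
Proof.
move=> g; apply: val_inj; rewrite /= /reduce_word foldr_cat.
by rewrite foldr_pushV.
Qed.

Lemma free_Vmul : right_inverse free_one free_inv free_mul.
Proof.
move=> g; have := free_mulV (free_inv g); congr (free_mul _ _ = _).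
by apply: val_inj; rewrite /= word_invK.
Qed.

HB.instance Definition _ := isGroup.Build free_group
  free_mulA free_mul1 free_1mul free_mulV free_Vmul.

End FreeGroup.

Section FreeAction.
Variable X : quandleType.
Implicit Types (x y : X) (g h : free_group X).

Definition letter_act x (a : X * bool) : X :=
  if a.2 then x ▷⁻¹ a.1 else x ▷ a.1.

Definition ract x g : X := foldl letter_act x (word g).
Definition lact g x : X := ract x (g^-1)%g.

Lemma letter_actK x a : letter_act (letter_act x a) (letter_inv a) = x.
Proof. by case: a => y [] /=; rewrite /letter_act /= (qinvK, qopK). Qed.

Lemma foldl_act_reduce x w :
  foldl letter_act x (reduce_word w) = foldl letter_act x w.
Proof.
elim: w x => [|a w IH] x //=; rewrite /reduce_word /= -/(reduce_word w) -IH.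
case: (reduce_word w) => [|b v] //=; case: eqP => [->|_] //=.
by rewrite letter_actK.
Qed.

Lemma ract1 x : ract x 1%g = x.
Proof. by []. Qed.

Lemma ractM x g h : ract x (g * h)%g = ract (ract x g) h.
Proof. by rewrite /ract /= foldl_act_reduce foldl_cat. Qed.

Definition tensor_step (u v : X * X) : Prop :=
  exists x y g, u = (ract x g, y) /\ v = (x, lact g y).

Definition tensor_rel : X * X -> X * X -> Prop :=
  clos_refl_sym_trans (X * X) tensor_step.

Definition swap (u : X * X) : X * X := (u.2, u.1).

Lemma swapK : involutive swap.
Proof. by case. Qed.

Lemma tensor_rel_swap u v : tensor_rel u v -> tensor_rel (swap u) (swap v).
Proof.
elim=> {u v} [u v [x [y [g [-> ->]]]]|u|u v _|u v w _ uv _ vw].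
- apply: rst_sym; apply: rst_step; exists y, x, (g^-1)%g.
  by rewrite /swap /lact /= invgK.
- exact: rst_refl.
- exact: rst_sym.
- exact: rst_trans uv vw.
Qed.

End FreeAction.

Section Tensor.
Variable X : finQuandleType.

Definition tensor_class (u : X * X) : {set X * X} :=
  [set v | `[< tensor_rel u v >]].

(* The quotient of X * X, as the set of its equivalence classes. *)
Definition tensor : {set {set X * X}} := [set tensor_class u | u : X * X].

Lemma imset_swap_inj : injective (fun c : {set X * X} => [set swap u | u in c]).
Proof. exact/imset_inj/(inv_inj (@swapK X)). Qed.

(* τ is given on all subsets of X * X; tau_class and tau_tensor show that it
   induces [(x, y)] |-> [(y, x)] on the tensor product. *)
Definition tau : {perm {set X * X}} := perm imset_swap_inj.

Lemma tau_class (x y : X) : tau (tensor_class (x, y)) = tensor_class (y, x).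
Proof.
rewrite permE; apply/setP => v; rewrite inE; apply/imsetP/asboolP => [[u]|yx_v].
  by rewrite inE => /asboolP /tensor_rel_swap xy_u ->.
by exists (swap v); rewrite ?swapK // inE; apply/asboolP/(tensor_rel_swap yx_v).
Qed.

Lemma tau_tensor c : c \in tensor -> tau c \in tensor.
Proof. by case/imsetP=> [[x y] _ ->]; rewrite tau_class imset_f. Qed.

Definition tau_orbit (c : {set X * X}) : {set {set X * X}} :=
  orbit 'P <[tau]>%g c.

Definition tensor_mod_tau : {set {set {set X * X}}} :=
  [set tau_orbit c | c in tensor].

End Tensor.

(* An alias of 'F_p depending on t, as the quandle structure does. *)
Definition affine (p : nat) (t : {unit 'F_p}) : Type := 'F_p.

Section Affine.
Import GRing.Theory.
Local Open Scope ring_scope.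
Variables (p : nat) (t : {unit 'F_p}).

Local Notation affine := (affine t).

HB.instance Definition _ := Finite.on affine.

Definition affine_op (x y : affine) : affine :=
  val t * (x : 'F_p) + (1 - val t) * (y : 'F_p).

Lemma affine_opxx x : affine_op x x = x.
Proof. by rewrite /affine_op -mulrDl addrC subrK mul1r. Qed.

Lemma affine_op_uniq x y : exists! z, x = affine_op z y.
Proof.
have tU : val t \is a GRing.unit by exact: (valP t).
exists ((val t)^-1 * ((x : 'F_p) - (1 - val t) * (y : 'F_p))); split.
  by rewrite /affine_op mulrA divrr // mul1r subrK.
by move=> z ->; rewrite /affine_op addrK mulrA mulVr // mul1r.
Qed.

Lemma affine_opD x y z :
  affine_op (affine_op x y) z = affine_op (affine_op x z) (affine_op y z).
Proof.
rewrite /affine_op !mulrDr -!addrA; congr (_ + _).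
rewrite [RHS]addrCA !mulrA [val t * (1 - _)]mulrC; congr (_ + _).
by rewrite -!mulrDl -mulrDr [val t + _]addrC subrK mulr1.
Qed.

HB.instance Definition _ := isQuandle.Build affine
  affine_opxx affine_op_uniq affine_opD.

(* The exponents 1, ..., n are written j.+1 with j : 'I_n. *)
Definition A_set (n : nat) (k : 'F_p) : {set affine * affine} :=
  [set (i, i + val t ^+ j.+1 * k) | i : 'F_p, j : 'I_n].

End Affine.

(* Main.v *)
Require Import Defs.
From mathcomp Require Import all_boot all_fingroup all_algebra.
From mathcomp Require Import boolp.
From Stdlib Require Import Relation_Operators.

(** The diagonal action of a free group letter on a pair of points of the
    affine quandle multiplies their difference by [t] or by its inverse, so
    along an equivalence class of the tensor product the difference only
    changes by a power of [t]. Conversely [(x, y)] is equivalent to [(x ▷ z,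
    y ▷ z)], and as [1 - t] is invertible (one has odd order, so [t] is not
    one), [z] can be chosen to put the first point anywhere while the
    difference is multiplied by [t]. Hence the class of [(x, y)] is exactly
    [A_set t n (y - x)] ([tensor_class_affine]), and tensor classes
    correspond to the orbits of multiplication by [t] on the field: the
    orbit of zero and [(p - 1) / n] orbits with [n] elements
    ([card_tensor_affine]).

    The involution replaces the difference [k] by [- k]. When [n] is even,
    [t ^+ n./2] is a square root of one other than one, thus equals [-1]; so
    [- k] lies in the orbit of [k], every class is fixed ([tau_affine]), and
    dividing by the involution changes nothing. *)

Set Implicit Arguments.
Unset Strict Implicit.
Unset Printing Implicit Defensive.

Import GRing.Theory Num.Theory.
Local Open Scope ring_scope.
Local Open Scope quandle_scope.

(* The library of group actions has another constant of this name. *)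
Local Notation ract := Defs.ract.

(** Acting by the letter [z] on both points is a single generating step, since
    the left action on the second point is inverse to the right action. *)
Lemma tensor_rel_qop (X : quandleType) (x y z : X) : tensor_rel (x, y) (x ▷ z, y ▷ z).
Proof.
pose g := @FreeGroup X [:: (z, false)] isT.
apply: rst_sym; apply: rst_step; exists x, (ract y g), g; split=> //.
by rewrite /lact -ractM mulgV ract1.
Qed.

Lemma tau_orbit_fixed (X : finQuandleType) (c : {set X * X}) :
  tau X c = c -> tau_orbit c = [set c].
Proof.
by move=> tau_c; apply/orbit1P; rewrite afix_cycle; apply/afix1P.
Qed.

Section PrimitiveRoot.
Variables (F : fieldType) (n : nat) (t : F).
Hypothesis t_order : n.-primitive_root t.

(** Multiplication by [t] has finite order, so its forward orbits are already
    closed under inverses and membership in them is symmetric. *)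
Lemma prim_expr_sym j (a b : F) :
  a = t ^+ j * b -> exists i, b = t ^+ i * a.
Proof.
move=> ->; exists (j * n.-1)%N; rewrite mulrA -exprD.
have n_gt0 := prim_order_gt0 t_order.
by rewrite -mulnSr prednK // mulnC exprM (prim_expr_order t_order) expr1n mul1r.
Qed.

(** Exponents shifted to the range from [1] to [n], as in [A_set]. *)
Lemma prim_expr_ord j : exists i : 'I_n, t ^+ i.+1 = t ^+ j.
Proof.
have n_gt0 := prim_order_gt0 t_order.
exists (Ordinal (ltn_pmod (j + n.-1) n_gt0)) => /=.
apply/eqP; rewrite (eq_prim_root_expr t_order) -addn1 modnDml.
by rewrite -addnA addn1 prednK // modnDr.
Qed.

Lemma prim_expr_half : ~~ odd n -> t ^+ n./2 = -1.
Proof.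
move=> n_even; have n_gt0 := prim_order_gt0 t_order.
have n_double : n./2.*2 = n by rewrite -[RHS]odd_double_half (negPf n_even).
have : (t ^+ n./2) ^+ 2 == 1.
  by rewrite -exprM muln2 n_double (prim_expr_order t_order).
rewrite sqrf_eq1 => /orP[|/eqP //].
have half_gt0 : (0 < n./2)%N by rewrite -double_gt0 n_double.
rewrite -(prim_order_dvd t_order) => /(dvdn_leq half_gt0).
by rewrite -{1}n_double -addnn -{3}[n./2]addn0 leq_add2l leqNgt half_gt0.
Qed.

End PrimitiveRoot.

Section AffineTensor.
Variables (p : nat) (t : {unit 'F_p}) (n : nat).
Hypothesis t_order : n.-primitive_root (val t : 'F_p).

Local Notation X := (affine t).
Local Notation T := (val t : 'F_p).

Definition diff (u : X * X) : 'F_p := (u.2 : 'F_p) - (u.1 : 'F_p).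

Lemma qop_affine (x y : X) :
  x ▷ y = T * (x : 'F_p) + (1 - T) * (y : 'F_p) :> 'F_p.
Proof. by []. Qed.

Lemma diff_qop (x y z : X) : diff (x ▷ z, y ▷ z) = T * diff (x, y).
Proof.
by rewrite /diff /= !qop_affine opprD addrACA subrr addr0 mulrBr.
Qed.

Lemma diff_letter_act (x y : X) a :
  exists j, diff (letter_act x a, letter_act y a) = T ^+ j * diff (x, y).
Proof.
case: a => z [] /=; rewrite /letter_act /=; last by exists 1%N; apply: diff_qop.
apply: (@prim_expr_sym _ _ _ t_order 1).
by rewrite expr1 -(diff_qop _ _ z) !qinvK.
Qed.

Lemma diff_ract (x y : X) g :
  exists j, diff (ract x g, ract y g) = T ^+ j * diff (x, y).
Proof.
rewrite /ract; elim: (word g) x y => [|a w IH] x y /=.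
  by exists 0%N; rewrite mul1r.
have [i ->] := IH (letter_act x a) (letter_act y a).
have [j ->] := diff_letter_act x y a.
by exists (i + j)%N; rewrite exprD mulrA.
Qed.

Lemma diff_tensor_rel (u v : X * X) :
  tensor_rel u v -> exists j, diff v = T ^+ j * diff u.
Proof.
elim=> {u v} [u v [x [y [g [-> ->]]]]|u|u v _ [j]|u v w _ [i uv] _ [j vw]].
- have [j] := diff_ract (ract x g) y (g^-1)%g.
  by rewrite -ractM mulgV ract1; exists j.
- by exists 0%N; rewrite mul1r.
- exact: (prim_expr_sym t_order).
- by exists (j + i)%N; rewrite vw uv exprD mulrA.
Qed.

Hypothesis t_neq1 : T != 1.

(** A single step already reaches any first point [i], by a suitable choice of
    the acting element; the remaining [j] steps return to [i] while multiplying
    the difference by [t]. *)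
Lemma tensor_rel_move (x y i : X) j :
  tensor_rel (x, y) (i, T ^+ j.+1 * diff (x, y) + (i : 'F_p) : 'F_p).
Proof.
have step (a b c : X) :
    tensor_rel (a, b) (c, T * diff (a, b) + (c : 'F_p) : 'F_p).
  have t1_neq0 : 1 - T != 0 by rewrite subr_eq0 eq_sym.
  (* The solution of the linear equation a ▷ z = c. *)
  pose z : X := (1 - T)^-1 * ((c : 'F_p) - T * (a : 'F_p)).
  have az : a ▷ z = c by rewrite [LHS]qop_affine mulVKf // addrC subrK.
  have := tensor_rel_qop a b z; rewrite -(diff_qop _ _ z) az /diff /=.
  by rewrite subrK.
elim: j => [|j IH]; first by rewrite expr1; apply: step.
apply: rst_trans IH _; rewrite [T ^+ j.+2]exprS -mulrA.
by have := step i (T ^+ j.+1 * diff (x, y) + (i : 'F_p)) i; rewrite [diff (i, _)]/diff addrK.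
Qed.

Lemma mem_A_set k (u : X * X) :
  reflect (exists j, diff u = T ^+ j * k) (u \in A_set t n k).
Proof.
apply: (iffP imset2P) => [[i j _ _ ->]|[j]].
  by exists j.+1; rewrite /diff /= addrC addKr.
case: u => x y; rewrite /diff /= => xy.
have [i ti] := prim_expr_ord t_order j.
by exists (x : 'F_p) i; rewrite // ti -xy addrC subrK.
Qed.

Lemma tensor_class_affine (u : X * X) : tensor_class u = A_set t n (diff u).
Proof.
apply/setP=> v; rewrite inE; apply/asboolP/mem_A_set.
  exact: diff_tensor_rel.
case: u v => x y [i z] [j vE]; have [k tk] := prim_expr_ord t_order j.
have := tensor_rel_move x y i k.
by rewrite tk -vE /diff /= subrK.
Qed.

Lemma A_set_eq (k l : 'F_p) :
  reflect (exists j, k = T ^+ j * l) (A_set t n k == A_set t n l).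
Proof.
apply: (iffP eqP) => [kl|[j kl]].
  pose u : X * X := ((0 : 'F_p), k).
  have uk : diff u = k by rewrite /diff subr0.
  have : u \in A_set t n l by rewrite -kl; apply/mem_A_set; exists 0%N; rewrite mul1r.
  by move/mem_A_set; rewrite uk.
apply/setP=> v; apply/mem_A_set/mem_A_set=> -[i ->].
  by exists (i + j)%N; rewrite kl exprD mulrA.
have [m ->] := prim_expr_sym t_order kl.
by exists (i + m)%N; rewrite exprD mulrA.
Qed.

Lemma tensor_affine : tensor X = [set A_set t n k | k : 'F_p].
Proof.
apply/setP=> c; apply/imsetP/imsetP=> [[u _ ->]|[k _ ->]].
  by exists (diff u); rewrite // tensor_class_affine.
exists ((0 : 'F_p) : X, k : X) => //.
by rewrite tensor_class_affine /diff subr0.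
Qed.

Lemma card_A_set_fiber (k : 'F_p) : k != 0 ->
  #|[set l : 'F_p | A_set t n l == A_set t n k]| = n.
Proof.
move=> k_neq0.
have -> : [set l : 'F_p | A_set t n l == A_set t n k]
        = [set T ^+ i.+1 * k | i : 'I_n].
  apply/setP=> l; rewrite inE; apply/A_set_eq/imsetP => [[j ->]|[i _ ->]].
    by have [i ti] := prim_expr_ord t_order j; exists i; rewrite // ti.
  by exists i.+1.
rewrite card_imset ?card_ord // => i j /(mulIf k_neq0)/eqP.
rewrite (eq_prim_root_expr t_order) -(addn1 i) -(addn1 j) eqn_modDr !modn_small // => /eqP.
exact: val_inj.
Qed.

(** Each nonzero class [A_set t n k] comes from exactly [n] values of [k], so
    the [p - 1] nonzero values of [k] give [(p - 1) / n] classes. *)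
Lemma card_tensor_affine : prime p ->
  #|tensor X|%:R = 1 + (p%:R - 1) / n%:R :> rat.
Proof.
move=> p_prime; pose A : 'F_p -> {set X * X} := A_set t n.
pose D := [set~ (0 : 'F_p)].
have A0 : A 0 \notin A @: D.
  apply/imsetP=> -[k]; rewrite !inE => k_neq0 /esym/eqP/A_set_eq[j].
  by rewrite mulr0; apply/eqP.
have fiber c : c \in A @: D -> (\sum_(k in D | A k == c) 1 = n)%N.
  case/imsetP=> k; rewrite !inE => k_neq0 c_k; rewrite -[RHS](card_A_set_fiber k_neq0).
  rewrite sum1dep_card; apply: eq_card => l; rewrite !inE c_k andb_idl //.
  move=> /eqP Al; apply/eqP => l0; case/imsetP: A0.
  by exists k; rewrite ?inE // -l0.
have tensorE : tensor X = A 0 |: A @: D.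
  rewrite tensor_affine -imsetU1 setUCr; apply/setP=> c.
  by apply/imsetP/imsetP=> -[k _ ->]; exists k; rewrite ?inE.
have : #|D| = (#|A @: D| * n)%N.
  rewrite -sum1_card (partition_big_imset A) /= -sum_nat_const.
  exact: eq_bigr.
rewrite cardsC1 card_Fp // => p1.
have n_neq0 : n%:R != 0 :> rat by rewrite pnatr_eq0 -lt0n (prim_order_gt0 t_order).
have -> : p%:R - 1 = p.-1%:R :> rat by rewrite -subn1 natrB ?prime_gt0.
by rewrite p1 natrM mulfK // tensorE cardsU1 A0 natrD.
Qed.

(** The involution negates the difference, and [-1] is the power [n./2] of [t]. *)
Lemma tau_affine c : ~~ odd n -> c \in tensor X -> tau X c = c.
Proof.
move=> n_even /imsetP[[x y] _ ->]; rewrite tau_class !tensor_class_affine.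
apply/eqP/A_set_eq; exists n./2.
by rewrite (prim_expr_half t_order n_even) mulN1r /diff opprB.
Qed.

End AffineTensor.

Theorem theorem7p9 (p : nat) (p_prime : prime p) (t : {unit 'F_p})
    (t_conn : connected_quandle (affine t))
    (n : nat) (t_order : n.-primitive_root (val t : 'F_p))
    (n_even : gcdn n 2 = 2%N) :
  (#|tensor_mod_tau (affine t)|%:R = 1 + (p%:R - 1) / n%:R :> rat) /\
  (forall o, o \in tensor_mod_tau (affine t) ->
     exists k : 'F_p,
       A_set t n k \in tensor (affine t) /\ o = tau_orbit (A_set t n k)).
Proof.
have n_dvd2 : (2 %| n)%N by rewrite -n_even dvdn_gcdl.
have n_odd : ~~ odd n by move: n_dvd2; rewrite dvdn2.
have t_neq1 : (val t : 'F_p) != 1.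
  rewrite -[val t]expr1 -(prim_order_dvd t_order) dvdn1.
  by apply: contraNneq n_odd => ->.
split=> [|o /imsetP[c c_tensor ->]].
  rewrite -(card_tensor_affine t_order t_neq1 p_prime); congr _%:R.
  apply: card_in_imset => c d /(tau_affine t_order t_neq1 n_odd) tau_c.
  move=> /(tau_affine t_order t_neq1 n_odd) tau_d.
  by rewrite !tau_orbit_fixed //; apply: set1_inj.
have := c_tensor; rewrite {1}(tensor_affine t_order t_neq1) => /imsetP[k _ c_k].
by exists k; rewrite -c_k.
Qed.
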